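(* Let $(A,\cdot)$ be a finite-dimensional associative algebra over a field $\mathbb{F}$ of characteristic zero, and let $(A,\circ)$ be the associative algebra over $\mathbb{F}$ with product $x\circ y=-y\cdot x$ for all $x,y\in A$. Then $(A,\cdot)$ satisfies $(x\cdot y)\cdot z=(y\cdot x)\cdot z$ for all $x,y,z\in A$ if and only if $(A,\circ)$ is a Novikov algebra.
   Context: A left-symmetric algebra over $\mathbb{F}$ is a vector space $A$ with a bilinear product $*$ such that $(x*y)*z-x*(y*z)=(y*x)*z-y*(x*z)$ for all $x,y,z\in A$ (in particular every associative algebra is left-symmetric). A Novikov algebra is a left-symmetric algebra $(A,* )$ satisfying $(x*y)*z=(x*z)*y$ for all $x,y,z\in A$. Associative algebras are not assumed to be unital. *)

(* Defs.v *)
From HB Require Import structures.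
From mathcomp Require Import all_boot all_order all_algebra.

Set Implicit Arguments.
Unset Strict Implicit.
Unset Printing Implicit Defensive.

Import GRing.Theory.
Local Open Scope ring_scope.

(* A not necessarily unital or associative algebra over F is a vector space A
   together with a product  mul : {bilinear A -> A -> A}.  MathComp's algType
   is not used because it is unital and associative. *)

Section Algebras.
Variables (F : fieldType) (A : lmodType F).
Implicit Type mul : {bilinear A -> A -> A}.

Definition associative_algebra mul : Prop := associative mul.

Definition left_symmetric_algebra mul : Prop :=
  forall x y z : A,
    mul (mul x y) z - mul x (mul y z) = mul (mul y x) z - mul y (mul x z).

Definition novikov_algebra mul : Prop :=
  left_symmetric_algebra mul /\
  (forall x y z : A, mul (mul x y) z = mul (mul x z) y).

Definition neg_opposite mul (x y : A) : A := - mul y x.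

Fact neg_opposite_is_bilinear mul :
  bilinear_for
    (GRing.Scale.Law.clone F A *:%R _) (GRing.Scale.Law.clone F A *:%R _)
    (neg_opposite mul).
Proof.
split=> u a x y; rewrite /neg_opposite.
  by rewrite linearPr opprD -scalerN.
by rewrite linearPl opprD -scalerN.
Qed.

HB.instance Definition _ mul :=
  bilinear_isBilinear.Build F A A A *:%R *:%R (neg_opposite mul)
    (neg_opposite_is_bilinear mul).

Fact neg_opposite_associative mul :
  associative_algebra mul -> associative_algebra (neg_opposite mul).
Proof.
by move=> mulA x y z; rewrite /= /neg_opposite linearNl linearNr mulA.
Qed.

End Algebras.

(* Main.v *)
Require Import Defs.
From mathcomp Require Import all_boot all_order all_algebra.
Set Implicit Arguments.
Unset Strict Implicit.
Unset Printing Implicit Defensive.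
Import GRing.Theory.
Local Open Scope ring_scope.

(** The two signs in a double product cancel: with [∘] for [neg_opposite mul], associativity gives
    [(x ∘ y) ∘ z = z(yx) = (zy)x]. Hence swapping [y] and [z] in [(x ∘ y) ∘ z] amounts to swapping
    the first two factors of [(zy)x], so the two identities coincide. *)

Theorem proposition8 (F : fieldType) (charF0 : [pchar F] =i pred0)
    (A : vectType F) (mul : {bilinear A -> A -> A})
    (mulA : associative_algebra mul) :
  (forall x y z : A, mul (mul x y) z = mul (mul y x) z) <->
  novikov_algebra (neg_opposite mul).
Proof.
have nopA := neg_opposite_associative mulA.
have nop2 x y z :
    neg_opposite mul (neg_opposite mul x y) z = mul (mul z y) x.
  by rewrite /neg_opposite linearNr opprK mulA.
split=> [mulC | [_ nopC] x y z]; last by rewrite -!nop2 nopC.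
split=> x y z; last by rewrite /= !nop2 mulC.
(* Left symmetry is automatic: both associators of [∘] vanish. *)
by rewrite !nopA !subrr.
Qed.
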